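(* Let $G=(V,E)$ be a finite strongly connected directed graph with transition matrix $H$, and let $\mu$ be the stationary distribution of $H$ (a probability row vector with $\mu H=\mu$). Consider the pull voter model with agnostic nodes on $G$ with matrix $H$ (either synchronous or asynchronous), with gnostic colours red and blue, started from a fixed initial configuration $S_0$, and let $S_t$ be the configuration at time $t$. Let $\mathcal{S}_0^{r}\in\{0,1\}^V$ be the column vector whose $v$-entry is $1$ if $v$ is red in $S_0$ and $0$ otherwise. For $t\ge 0$ let $P_t\in[0,1]^V$ be the column vector whose $v$-entry $P_t(v)$ is the probability that $v$ is red at round $t$ (i.e. in $S_t$) and $v$ selects an agnostic out-neighbour at round $t$. Suppose that $G$ is such that the process on $G$ always converges. Let $p$ be the probability that the process reaches red consensus. Then $$p=\mu\,\mathcal{S}_0^{r}+\mu\sum_{t=0}^{\infty}P_t .$$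
   Context: Setting. $G=(V,E)$ is a finite strongly connected directed graph (self-loops allowed), $n=|V|$. The transition matrix $H$ is a row-stochastic $V\times V$ matrix with $H(v,u)>0$ if $(v,u)\in E$ and $H(v,u)=0$ otherwise. Pull voter model with agnostic nodes. Each node is, at each time, either agnostic (no colour) or gnostic; gnostic nodes are coloured red or blue. In the synchronous version, at each round every node $v$ independently selects an out-neighbour $u$ with probability $H(v,u)$. If $u$ is agnostic, $v$ keeps its current state; if $u$ is gnostic, $v$ copies the colour of $u$. All updates use the states at the start of the round and occur simultaneously. In the asynchronous version, at each round one node $v$ is chosen uniformly at random from $V$, it alone selects an out-neighbour (with probabilities $H(v,\cdot)$) and updates by the same rule; all other nodes select nobody and keep their state. $S_{t+1}$ is the configuration produced from $S_t$ by round $t$. Red consensus (red wins) means that a configuration in which all nodes are red is reached. The process always converges on $G$ if, from every initial configuration with at least one gnostic node, with probability 1 a configuration in which all nodes have the same gnostic colour is eventually reached. *)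

(* Defs.v *)
From HB Require Import structures.
From mathcomp Require Import all_boot all_order all_algebra.
From mathcomp Require Import finmap.
From mathcomp Require Import all_classical all_reals all_analysis.

Set Implicit Arguments.
Unset Strict Implicit.
Unset Printing Implicit Defensive.

Import Order.TTheory GRing.Theory Num.Theory.

Local Open Scope classical_set_scope.
Local Open Scope ring_scope.

Inductive colour := Red | Blue.

Definition bool_of_colour (k : colour) : bool := if k is Red then true else false.
Definition colour_of_bool (b : bool) : colour := if b then Red else Blue.
Lemma bool_of_colourK : cancel bool_of_colour colour_of_bool.
Proof. by case. Qed.

HB.instance Definition _ := Finite.copy colour (can_type bool_of_colourK).

Inductive update_mode := Synchronous | Asynchronous.

Definition strongly_connected (V : finType) (E : rel V) : Prop :=
  forall u v : V, connect E u v.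

Definition transition_matrix (R : realType) (V : finType) (E : rel V)
    (H : V -> V -> R) : Prop :=
  [/\ forall v u, E v u -> 0 < H v u,
      forall v u, ~~ E v u -> H v u = 0
    & forall v, \sum_u H v u = 1].

Definition stationary_distribution (R : realType) (V : finType)
    (H : V -> V -> R) (mu : V -> R) : Prop :=
  [/\ forall v, 0 <= mu v,
      \sum_v mu v = 1
    & forall u, \sum_v mu v * H v u = mu u].

(* [None] is the agnostic state; [Some k] is gnostic with colour [k]. *)
Definition config (V : finType) := {ffun V -> option colour}.

(* The choices made in one round: [s v = Some u] when [v] selects [u],
   [s v = None] when [v] selects nobody. *)
Definition selection (V : finType) := {ffun V -> option V}.

Definition single_selection (V : finType) (v u : V) : selection V :=
  [ffun w => if w == v then Some u else None].

(* Probability that the choices made in one round are exactly [s].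
   Synchronous: the nodes choose independently, and every node chooses.
   Asynchronous: one node [v], uniform in [V], chooses according to [H v]. *)
Definition selection_law (R : realType) (V : finType) (m : update_mode)
    (H : V -> V -> R) (s : selection V) : R :=
  match m with
  | Synchronous => \prod_v (if s v is Some u then H v u else 0)
  | Asynchronous =>
      \sum_v \sum_u (if s == single_selection v u then #|V|%:R^-1 * H v u else 0)
  end.

Definition pull_step (V : finType) (s : selection V) (c : config V) : config V :=
  [ffun v => if s v is Some u
             then if c u is Some k then Some k else c v
             else c v].

Section Process.
Context (R : realType) (V : finType) (d : measure_display)
  (Omega : measurableType d) (P : probability Omega R).
Local Open Scope ereal_scope.

(* [sel t] is the random selection of round [t]: the rounds are mutually
   independent (product rule over finite subfamilies) and identically
   distributed.  [selection V] carries the discrete sigma-algebra. *)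
Record random_selections (m : update_mode) (H : V -> V -> R)
    (sel : nat -> Omega -> selection V) : Prop := RandomSelections {
  selections_measurable : forall (t : nat) (A : set (selection V)),
    measurable (sel t @^-1` A);
  selections_law : forall (t : nat) (s : selection V),
    P (sel t @^-1` [set s]) = (selection_law m H s)%:E;
  selections_independent : forall (J : {fset nat}) (A : nat -> set (selection V)),
    P (\bigcap_(t in [set` J]) (sel t @^-1` A t)) =
    \prod_(t <- J) P (sel t @^-1` A t)
}.

Fixpoint state (sel : nat -> Omega -> selection V) (c0 : config V) (t : nat)
    (w : Omega) : config V :=
  if t is t'.+1 then pull_step (sel t' w) (state sel c0 t' w) else c0.

Definition consensus (k : colour) (c : config V) : Prop := forall v, c v = Some k.

Definition reaches_consensus (sel : nat -> Omega -> selection V) (c0 : config V)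
    (k : colour) : set Omega :=
  [set w | exists t, consensus k (state sel c0 t w)].

(* The laws of the processes started from all the initial configurations are
   determined by the law of [sel], so a single [sel] serves for all of them. *)
Definition always_converges (sel : nat -> Omega -> selection V) : Prop :=
  forall c0 : config V, (exists v, c0 v <> None) ->
    P [set w | exists t k, consensus k (state sel c0 t w)] = 1.

Definition red_selects_agnostic (sel : nat -> Omega -> selection V)
    (c0 : config V) (t : nat) (v : V) : set Omega :=
  [set w | state sel c0 t w v = Some Red /\
           exists u, sel t w v = Some u /\ state sel c0 t w u = None].

End Process.

Definition red_indicator (R : realType) (V : finType) (c : config V) (v : V) : R :=
  if c v == Some Red then 1 else 0.

(* Main.v *)
(* Let W_t be the mu-weighted probability of being red, W_t = sum_v mu(v) P(v is red
   at t). A node that selects u becomes red exactly when u is red, or when it was red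
   and u is agnostic; since mu H = mu, the red selections preserve the weight in
   expectation, so W_{t+1} = W_t + mu P_t and W_T = mu S_0^r + sum_{t<T} mu P_t.
   Averaging over mu gives P(red consensus at t) <= W_t <= 1 - P(blue consensus at t),
   and when the process converges both bounds tend to p. An entirely agnostic S_0 is
   not covered by the convergence hypothesis, but then every term is zero. *)
Require Import Defs.
From HB Require Import structures.
From mathcomp Require Import all_boot all_order all_algebra finmap.
From mathcomp Require Import all_classical all_reals all_analysis.
From mathcomp Require Import ring.

Set Implicit Arguments.
Unset Strict Implicit.
Unset Printing Implicit Defensive.

Import Order.TTheory GRing.Theory Num.Theory.

Local Open Scope ring_scope.
Local Open Scope ereal_scope.

(** * One-round laws of the selections and the drift of the red weight *)

Section SelectionLaw.
Context (R : realType) (V : finType) (E : rel V) (H : V -> V -> R)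
  (hH : transition_matrix E H).
Local Open Scope ring_scope.

Lemma big_option (T : finType) (F : option T -> R) :
  \sum_o F o = F None + \sum_x F (Some x).
Proof.
rewrite (bigD1 None)//=; congr (_ + _).
rewrite (reindex_omap Some id) => [|[]//].
by apply: eq_bigl => x; rewrite /= eqxx.
Qed.

(** Marginal of a product law: by distributivity the sum factors over the nodes, and every factor
    other than that of [v] is a row sum of [H], hence 1. *)
Lemma sum_synchronous_law (v : V) (f : option V -> R) :
  \sum_s selection_law Synchronous H s * f (s v) = \sum_u H v u * f (Some u).
Proof.
case: hH => _ _ h1.
pose K w o : R := if o is Some u then H w u else 0.
(* Putting [f] into the factor of coordinate [v] turns the whole summand into a product over
   nodes. *)
pose F w o := K w o * (if w == v then f o else 1).
transitivity (\sum_(s : selection V) \prod_w F w (s w)).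
  apply: eq_bigr => s _; rewrite big_split/=; congr (_ * _).
  by rewrite -big_mkcond big_pred1_eq.
transitivity (\prod_w \sum_o F w o); first by rewrite bigA_distr_bigA.
rewrite (bigD1 v)//= [X in _ * X]big1 ?mulr1 => [|w wv].
  rewrite big_option /F/= mul0r add0r.
  by apply: eq_bigr => u _; rewrite eqxx.
rewrite big_option /F /K /= mul0r add0r -[RHS](h1 w).
by apply: eq_bigr => u _; rewrite (negPf wv) mulr1.
Qed.

(** Node [v] is the chosen one with probability $1/|V|$; each of the other $|V|-1$ choices leaves it
    with [None]. *)
Lemma sum_asynchronous_law (v : V) (f : option V -> R) :
  \sum_s selection_law Asynchronous H s * f (s v) =
  #|V|%:R^-1 * (\sum_u H v u * f (Some u)) + (1 - #|V|%:R^-1) * f None.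
Proof.
case: hH => _ _ h1.
have V0 : #|V|%:R != 0 :> R.
  by rewrite pnatr_eq0 -lt0n; apply/card_gt0P; exists v.
transitivity (\sum_w \sum_u #|V|%:R^-1 * H w u * f (single_selection w u v)).
  under eq_bigr do rewrite /= mulr_suml.
  rewrite exchange_big; apply: eq_bigr => w _.
  under eq_bigr do rewrite mulr_suml.
  rewrite exchange_big; apply: eq_bigr => u _.
  rewrite (bigD1 (single_selection w u))//= eqxx big1 ?addr0// => s /negPf ->.
  by rewrite mul0r.
rewrite (bigD1 v)//=; congr (_ + _).
  rewrite mulr_sumr; apply: eq_bigr => u _.
  by rewrite ffunE eqxx mulrA.
transitivity (\sum_(w | w != v) #|V|%:R^-1 * f None).
  apply: eq_bigr => w /negPf wv; rewrite -[X in _ = X * _]mulr1 -(h1 w).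
  rewrite mulr_sumr mulr_suml; apply: eq_bigr => u _.
  by rewrite ffunE eq_sym wv.
rewrite sumr_const -[LHS]mulr_natl mulrA; congr (_ * _).
have -> : #|[pred w | w != v]| = #|V|.-1.
  by have := cardC1 v; rewrite -(@eq_card _ (predC1 v)).
have n0 : (0 < #|V|)%N by apply/card_gt0P; exists v.
by rewrite -subn1 natrB// mulrBl mulfV// mul1r.
Qed.

(* [a] is the probability that a given node selects somebody in one round. *)
Lemma sum_selection_law (m : update_mode) : exists a : R,
  forall (v : V) (f : option V -> R),
  \sum_s selection_law m H s * f (s v) =
  a * (\sum_u H v u * f (Some u)) + (1 - a) * f None.
Proof.
case: m; last by exists #|V|%:R^-1; exact: sum_asynchronous_law.
by exists 1 => v f; rewrite sum_synchronous_law subrr mul0r addr0 mul1r.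
Qed.

(** The value at [None] is false: an idle node selects no agnostic neighbour. *)
Definition selects_agnostic (c : config V) (o : option V) : bool :=
  if o is Some u then c u == None else false.

Lemma stationary_red_drift (mu : V -> R) (m : update_mode) (c : config V) :
  stationary_distribution H mu ->
  \sum_v mu v * (\sum_s selection_law m H s * (pull_step s c v == Some Red)%:R)
  = \sum_v mu v * (\sum_s selection_law m H s * (c v == Some Red)%:R)
  + \sum_v mu v * (\sum_s selection_law m H s *
                   ((c v == Some Red) && selects_agnostic c (s v))%:R).
Proof.
case=> _ _ stat; have [a sumE] := sum_selection_law m.
case: hH => _ _ h1.
pose r v : R := (c v == Some Red)%:R.
pose g v o : R := ((c v == Some Red) && selects_agnostic c o)%:R.
(* The two ways of being red after selecting [u] ([u] red; [u] agnostic and [v] red) exclude each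
   other, so their indicators add. *)
have stepE v s : (pull_step s c v == Some Red)%:R =
    (if s v is Some u then r u + g v (Some u) else r v).
  rewrite ffunE /r /g /selects_agnostic; case: (s v) => // u.
  by case: (c u) => [[]|] /=; rewrite ?andbF ?andbT ?addr0 ?add0r.
have step v : \sum_s selection_law m H s * (pull_step s c v == Some Red)%:R =
    a * (\sum_u H v u * r u) + (1 - a) * r v +
    a * (\sum_u H v u * g v (Some u)).
  under eq_bigr do rewrite stepE.
  rewrite (sumE v (fun o => if o is Some u then r u + g v (Some u) else r v)).
  under eq_bigr do rewrite mulrDr.
  by rewrite big_split/=; ring.
have stay v : \sum_s selection_law m H s * (c v == Some Red)%:R = r v.
  by rewrite (sumE v (fun=> r v)) -mulr_suml h1; ring.
have agn v : \sum_s selection_law m H s *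
    ((c v == Some Red) && selects_agnostic c (s v))%:R =
    a * (\sum_u H v u * g v (Some u)).
  by rewrite (sumE v (g v)) /g /selects_agnostic andbF mulr0 addr0.
under eq_bigr do rewrite step mulrDr.
under [X in _ = X + _]eq_bigr do rewrite stay.
under [X in _ = _ + X]eq_bigr do rewrite agn.
rewrite big_split/=; congr (_ + _).
transitivity (a * (\sum_v mu v * \sum_u H v u * r u) +
              (1 - a) * \sum_v mu v * r v).
  rewrite !mulr_sumr -big_split; apply: eq_bigr => v _ /=; ring.
(* Stationarity, $\mu H r=\mu r$, makes the selecting share [a] and the idle share [1 - a] add up to
   $\mu r$, whatever [a] is. *)
suff -> : \sum_v mu v * (\sum_u H v u * r u) = \sum_v mu v * r v by ring.
under eq_bigr do rewrite mulr_sumr.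
rewrite exchange_big; apply: eq_bigr => u _.
by rewrite -[in RHS]stat mulr_suml; apply: eq_bigr => v _; rewrite mulrA.
Qed.

End SelectionLaw.

(** * Random variables with finitely many values *)

Section FiniteProbability.
Context (R : realType) (d : measure_display) (Omega : measurableType d)
  (P : probability Omega R) (T : finType) (X : Omega -> T)
  (mX : forall x, measurable (X @^-1` [set x])%classic).
Local Open Scope classical_set_scope.

Lemma preimage_bigcupE (B : set Omega) :
  B = \bigcup_(x in [set` enum T]) (X @^-1` [set x] `&` B).
Proof.
apply/seteqP; split => [w Bw|w [x _ []//]].
by exists (X w); rewrite //= mem_enum.
Qed.

(** A preimage is a finite union of its intersections with fibres, each of which is a whole fibre or
    empty. *)
Lemma measurable_fin_preimage (A : set T) : measurable (X @^-1` A).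
Proof.
rewrite (preimage_bigcupE (X @^-1` A)).
apply: fin_bigcup_measurable => // x _.
have [Ax|nAx] := pselect (A x).
  by rewrite setIidl// => w /= ->.
suff -> : X @^-1` [set x] `&` X @^-1` A = set0 by [].
by apply/seteqP; split => // w [/= ->].
Qed.

Lemma measure_fin_partition (B : set Omega) : measurable B ->
  P B = \sum_x P (X @^-1` [set x] `&` B).
Proof.
move=> mB; rewrite {1}(preimage_bigcupE B) measure_fin_bigcup//=.
- by rewrite -fsbig_seq ?enum_uniq// big_enum.
- by apply/trivIsetP => x y _ _ /eqP xy; apply/seteqP; split => // w [[/= -> _] [/= /xy]].
- by move=> x _; exact: measurableI.
Qed.

End FiniteProbability.

(** * Joint law of state and selection, and the recursion for the red weight *)

Section Process.
Context (R : realType) (V : finType) (E : rel V) (H : V -> V -> R)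
  (m : update_mode) (d : measure_display) (Omega : measurableType d)
  (P : probability Omega R) (sel : nat -> Omega -> selection V)
  (S0 : config V) (hH : transition_matrix E H)
  (hsel : random_selections P m H sel).
Local Open Scope classical_set_scope.

(** State and selection are treated as a pair because the next state is a function of both. *)
Lemma measurable_state_selection t (cs : config V * selection V) :
  measurable ((fun w => (state sel S0 t w, sel t w)) @^-1` [set cs]).
Proof.
elim: t cs => [|t IH] [c s].
  rewrite (_ : _ @^-1` _ = [set w | S0 = c] `&` sel 0%N @^-1` [set s]).
    apply: measurableI; last exact: (selections_measurable hsel).
    by have [->|nc] := eqVneq S0 c; [rewrite (_ : mkset _ = setT)//|
       rewrite (_ : mkset _ = set0)//]; apply/seteqP; split => // w /= /eqP;
       rewrite (negPf nc).
  by apply/seteqP; split => w /= [-> ->].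
rewrite (_ : _ @^-1` _ =
  (fun w => (state sel S0 t w, sel t w)) @^-1`
    [set cs | pull_step cs.2 cs.1 = c] `&` sel t.+1 @^-1` [set s]).
  apply: measurableI; last exact: (selections_measurable hsel).
  exact: (@measurable_fin_preimage _ _ (config V * selection V)%type _ IH).
by apply/seteqP; split => w /= [-> ->].
Qed.

Lemma measurable_state t (A : set (config V)) :
  measurable (state sel S0 t @^-1` A).
Proof.
exact: (measurable_fin_preimage (@measurable_state_selection t) (fst @^-1` A)).
Qed.

Lemma measurable_selection_bigcap (J : {fset nat}) (A : nat -> set (selection V)) :
  measurable (\bigcap_(j in [set` J]) sel j @^-1` A j).
Proof.
rewrite bigcap_fset; elim/big_ind: _ => //; first exact: measurableI.
by move=> j _; exact: (selections_measurable hsel).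
Qed.

(* Quantifying over families [J] of later rounds makes the induction on [t] go
   through: conditioning on the selection of round [t] adds [t] to [J]. *)
Lemma state_selections_independent t (J : {fset nat})
    (A : nat -> set (selection V)) (c : config V) :
  (forall j, j \in J -> (t <= j)%N) ->
  P (state sel S0 t @^-1` [set c] `&` \bigcap_(j in [set` J]) sel j @^-1` A j)
  = P (state sel S0 t @^-1` [set c]) * \prod_(j <- J) P (sel j @^-1` A j).
Proof.
elim: t J A c => [|t IH] J A c leJ.
  rewrite -(selections_independent hsel).
  have [c0|nc] := eqVneq S0 c.
    rewrite (_ : _ @^-1` [set c] = setT); last first.
      by apply/seteqP; split => w //= _; rewrite c0.
    by rewrite setTI probability_setT mul1e.
  rewrite (_ : _ @^-1` [set c] = set0); last first.
    by apply/seteqP; split => w //= /eqP; rewrite (negPf nc).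
  by rewrite set0I measure0 mul0e.
(* The event is split according to the state and selection of round [t]. The family [K] is left free
   because the formula is used twice: for [J], and for the empty family, which gives the law of the
   state alone. *)
have split_step (K : {fset nat}) (B : nat -> set (selection V)) :
    (forall j, j \in K -> (t.+1 <= j)%N) ->
    P (state sel S0 t.+1 @^-1` [set c] `&` \bigcap_(j in [set` K]) sel j @^-1` B j)
    = \sum_(cs : config V * selection V) (if pull_step cs.2 cs.1 == c
        then P (state sel S0 t @^-1` [set cs.1]) * P (sel t @^-1` [set cs.2])
        else 0) * \prod_(j <- K) P (sel j @^-1` B j).
  move=> leK; have tK : t \notin K by apply/negP => /leK; rewrite ltnn.
  rewrite (measure_fin_partition P (@measurable_state_selection t)); last first.
    by apply: measurableI; [exact: measurable_state|
                            exact: measurable_selection_bigcap].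
  apply: eq_bigr => -[c' s] _ /=.
  case: eqP => [stepc|nstep]; last first.
    rewrite mul0e (_ : _ `&` _ = set0) ?measure0//.
    apply/seteqP; split => // w [/= [c'E sE] [stepE _]].
    by apply: nstep; rewrite -c'E -sE.
  (* The condition on round [t] joins the later ones, so the induction hypothesis applies to the
     family enlarged by [t]. *)
  pose B' j := if j == t then [set s] else B j.
  have B't : B' t = [set s] by rewrite /B' eqxx.
  have B'K j : j \in K -> B' j = B j.
    by rewrite /B'; case: eqP => // -> ; rewrite (negPf tK).
  transitivity (P (state sel S0 t @^-1` [set c'] `&`
      \bigcap_(j in [set` (t |` K)%fset]) sel j @^-1` B' j)).
    congr (P _); rewrite bigcap_fsetU1 B't.
    apply/seteqP; split => [w [/= [cE sE] [_ KB]]|w [/= cE [sE KB]]].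
      by split => //; split => // j jK; rewrite B'K//; exact: KB.
    do 2![split; first by rewrite /= cE sE].
    by move=> j jK; rewrite -B'K//; exact: KB.
  rewrite IH; last by move=> j; rewrite !inE => /orP[/eqP->//|/leK/ltnW].
  rewrite big_fsetU1//= B't muleA; congr (_ * _).
  by rewrite !big_seq; apply: eq_bigr => j /B'K ->.
rewrite split_step// -ge0_sume_distrl; last first.
  by move=> cs _; case: ifP => // _; rewrite mule_ge0.
congr (_ * _); have := split_step fset0 A.
rewrite [[set` fset0]](_ : _ = set0); last by apply/seteqP; split.
rewrite bigcap_set0 setIT => ->//.
by apply: eq_bigr => cs _; rewrite big_nil mule1.
Qed.

Definition state_prob t c : R := fine (P (state sel S0 t @^-1` [set c])).

(** The state at [t] is built from earlier selections, hence independent of [sel t]; the joint law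
    is the product of [state_prob] and [selection_law]. *)
Lemma event_prob t (g : config V -> selection V -> bool) :
  P [set w | g (state sel S0 t w) (sel t w)] =
  (\sum_c state_prob t c * \sum_s selection_law m H s * (g c s)%:R)%R%:E.
Proof.
rewrite (measure_fin_partition P (@measurable_state_selection t)); last first.
  exact: (measurable_fin_preimage (@measurable_state_selection t)
            [set cs | g cs.1 cs.2]).
under [in RHS]eq_bigr do rewrite mulr_sumr.
rewrite pair_bigA/= -sumEFin; apply: eq_bigr => -[c s] _ /=.
case: (boolP (g c s)) => gcs; last first.
  rewrite !mulr0 (_ : _ `&` _ = set0) ?measure0//.
  by apply/seteqP; split => // w [/= [-> ->]]; rewrite (negPf gcs).
rewrite mulr1 EFinM -(selections_law hsel t) fineK ?fin_num_measure//; last first.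
  exact: measurable_state.
have := @state_selections_independent t [fset t]%fset (fun=> [set s]) c.
rewrite big_seq_fset1 => <-; last by move=> j; rewrite inE => /eqP ->.
congr (P _); rewrite set_fset1 bigcap_set1.
by apply/seteqP; split => [w [/= [<- <-]]|w [/= -> ->]].
Qed.

Definition red_prob t v : R := fine (P [set w | state sel S0 t w v = Some Red]).

Definition red_weight (mu : V -> R) t : R := \sum_v mu v * red_prob t v.

Definition agnostic_prob t v : R := fine (P (red_selects_agnostic sel S0 t v)).

(** Boolean form of the event, as [event_prob] requires. *)
Lemma red_selects_agnosticE t v :
  red_selects_agnostic sel S0 t v =
  [set w | (state sel S0 t w v == Some Red) &&
           selects_agnostic (state sel S0 t w) (sel t w v)].
Proof.
rewrite /red_selects_agnostic; apply/seteqP; split => w /=.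
  by move=> [-> [u [-> ucN]]]; rewrite eqxx /= ucN.
by case/andP => /eqP ->; case: (sel t w v) => // u /eqP uN; split => //; exists u.
Qed.

Lemma measurable_red t v : measurable [set w | state sel S0 t w v = Some Red].
Proof. exact: (measurable_state t [set c | c v = Some Red]). Qed.

Lemma measurable_red_selects_agnostic t v :
  measurable (red_selects_agnostic sel S0 t v).
Proof.
rewrite red_selects_agnosticE.
exact: (measurable_fin_preimage (@measurable_state_selection t)
  [set cs : config V * selection V | (cs.1 v == Some Red) && selects_agnostic cs.1 (cs.2 v)]).
Qed.

Lemma red_weightS mu t : stationary_distribution H mu ->
  red_weight mu t.+1 = (red_weight mu t + \sum_v mu v * agnostic_prob t v)%R.
Proof.
move=> hmu; rewrite /red_weight.
have E1 v : red_prob t.+1 v = (\sum_c state_prob t c *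
    \sum_s selection_law m H s * (pull_step s c v == Some Red)%:R)%R.
  rewrite -[RHS]/(fine _%:E) -(event_prob t (fun c s => pull_step s c v == Some Red)).
  by rewrite /red_prob; congr (fine (P _)); apply/seteqP; split => w /= /eqP.
have E2 v : red_prob t v = (\sum_c state_prob t c *
    \sum_s selection_law m H s * (c v == Some Red)%:R)%R.
  rewrite -[RHS]/(fine _%:E) -(event_prob t (fun c s => c v == Some Red)).
  by rewrite /red_prob; congr (fine (P _)); apply/seteqP; split => w /= /eqP.
have E3 v : agnostic_prob t v = (\sum_c state_prob t c *
    \sum_s selection_law m H s *
      ((c v == Some Red) && selects_agnostic c (s v))%:R)%R.
  rewrite /agnostic_prob red_selects_agnosticE.
  by rewrite (event_prob t (fun c s => (c v == Some Red) && selects_agnostic c (s v))).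
under eq_bigr do rewrite E1.
under [X in _ = (X + _)%R]eq_bigr do rewrite E2.
under [X in _ = (_ + X)%R]eq_bigr do rewrite E3.
(* With the sum over configurations outermost, the one-round drift applies to each configuration
   separately. *)
have swap (F : V -> config V -> R) :
    (\sum_v mu v * (\sum_c state_prob t c * F v c) =
     \sum_c state_prob t c * (\sum_v mu v * F v c))%R.
  under eq_bigr do rewrite mulr_sumr.
  rewrite exchange_big; apply: eq_bigr => c _; rewrite mulr_sumr.
  by apply: eq_bigr => v _; rewrite mulrCA.
rewrite !swap -big_split; apply: eq_bigr => c _ /=.
by rewrite -mulrDr (stationary_red_drift hH).
Qed.

End Process.

(** * Consensus is absorbing *)

Section Consensus.
Context (V : finType) (d : measure_display) (Omega : measurableType d)
  (sel : nat -> Omega -> selection V)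
  (S0 : config V).
Local Open Scope classical_set_scope.

Lemma consensus_step k s (c : config V) : consensus k c -> consensus k (pull_step s c).
Proof. by move=> ck v; rewrite ffunE; case: (s v) => // u; rewrite ck. Qed.

Lemma consensus_le k t t' w : (t <= t')%N ->
  consensus k (state sel S0 t w) -> consensus k (state sel S0 t' w).
Proof.
move=> /subnKC <-; elim: (t' - t)%N => [|i IH]; first by rewrite addn0.
by move=> /IH; rewrite addnS; exact: consensus_step.
Qed.

Lemma reaches_consensusE k : reaches_consensus sel S0 k =
  \bigcup_t (state sel S0 t @^-1` [set c | consensus k c]).
Proof. by apply/seteqP; split => w [t]; [exists t|move=> _ ?; exists t]. Qed.

(** At the later of the two times [v] would have both colours. A node is required: on an empty [V]
    both consensuses hold vacuously. *)
Lemma reaches_consensus_disjoint (v : V) :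
  reaches_consensus sel S0 Red `&` reaches_consensus sel S0 Blue = set0.
Proof.
apply/seteqP; split => // w [[t /consensus_le rt] [t' /consensus_le bt]].
have := rt _ (leq_maxl t t') v.
by rewrite (bt _ (leq_maxr t t') v).
Qed.

(** Serves the initial configuration about which [always_converges] says nothing. *)
Lemma agnostic_state t w : (forall v, S0 v = None) -> state sel S0 t w = S0.
Proof.
move=> S0N; elim: t => //= t ->; apply/ffunP => v; rewrite ffunE.
by case: (sel t w v) => // u; rewrite S0N.
Qed.

End Consensus.

(** * Limit of the red weight *)

Section Limit.
Context (R : realType) (V : finType) (H : V -> V -> R) (mu : V -> R)
  (m : update_mode) (d : measure_display) (Omega : measurableType d)
  (P : probability Omega R) (sel : nat -> Omega -> selection V) (S0 : config V)
  (hmu : stationary_distribution H mu)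
  (hsel : random_selections P m H sel) (hconv : always_converges P sel).
Local Open Scope classical_set_scope.

Let consensus_at k t := state sel S0 t @^-1` [set c | consensus k c].

Let measurable_consensus_at k t : measurable (consensus_at k t).
Proof. exact: (measurable_state S0 hsel). Qed.

Lemma measurable_reaches_consensus k : measurable (reaches_consensus sel S0 k).
Proof.
by rewrite reaches_consensusE; apply: bigcupT_measurable => t; exact: measurable_consensus_at.
Qed.

(** Continuity from below: the events increase with [t] since consensus is absorbing. *)
Lemma consensus_at_cvg k :
  P (consensus_at k t) @[t --> \oo] --> P (reaches_consensus sel S0 k).
Proof.
rewrite reaches_consensusE; apply: (@nondecreasing_cvg_mu _ _ _ P (consensus_at k)).
- exact: measurable_consensus_at.
- by apply: bigcupT_measurable => t; exact: measurable_consensus_at.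
- by move=> t t' tt'; apply/subsetPset => w; exact: consensus_le.
Qed.

Lemma stationary_inhabited : inhabited V.
Proof.
case: hmu => _ mu1 _; have [v _|V0] := pickP (@predT V); first by constructor.
by move: mu1; rewrite big_pred0 => // /esym/eqP; rewrite oner_eq0.
Qed.

Lemma reaches_consensus_total : (exists v, S0 v <> None) ->
  P (reaches_consensus sel S0 Red) + P (reaches_consensus sel S0 Blue) = 1.
Proof.
move=> /hconv <-; have [v] := stationary_inhabited.
rewrite -measureU; [congr (P _)|exact: measurable_reaches_consensus..|
                    exact: reaches_consensus_disjoint].
apply/seteqP; split => [w [[t ?]|[t ?]]|w [t [[] ?]]].
- by exists t, Red.
- by exists t, Blue.
- by left; exists t.
- by right; exists t.
Qed.

Lemma average_bounds (f : V -> R) (a b : R) :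
  (forall v, a <= f v <= b)%R -> (a <= \sum_v mu v * f v <= b)%R.
Proof.
case: hmu => mu0 mu1 _ fab; rewrite -[a]mul1r -[b]mul1r -mu1 !mulr_suml.
by apply/andP; split; apply: ler_sum => v _; apply: ler_wpM2l => //;
  case/andP: (fab v).
Qed.

(** For each [v], red consensus forces [v] to be red, and a red [v] rules out blue consensus;
    averaging over [mu] keeps both bounds. *)
Lemma red_weight_bounds t :
  P (consensus_at Red t) <= (red_weight P sel S0 mu t)%:E
    <= 1 - P (consensus_at Blue t).
Proof.
rewrite -(fineK (fin_num_measure P _ (measurable_consensus_at Red t))).
rewrite -(fineK (fin_num_measure P _ (measurable_consensus_at Blue t))).
rewrite -EFinB !lee_fin; apply: average_bounds => v.
have mred := measurable_red S0 hsel t v.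
apply/andP; split; rewrite -lee_fin ?EFinB !fineK ?fin_num_measure//.
  by apply: le_measure; rewrite ?inE// => w /= /(_ v).
rewrite -probability_setC//; apply: le_measure; rewrite ?inE//.
  exact: measurableC.
by move=> w /= red /(_ v); rewrite red.
Qed.

Lemma red_weight_cvg :
  (red_weight P sel S0 mu t)%:E @[t --> \oo] --> P (reaches_consensus sel S0 Red).
Proof.
have [gnostic|/forallNP agnostic] := pselect (exists v, S0 v <> None).
  apply: (@squeeze_cvge _ _ _ _ (fun t => P (consensus_at Red t)) _
    (fun t => 1 - P (consensus_at Blue t))).
  - by apply: nearW => t; exact: red_weight_bounds.
  - exact: consensus_at_cvg.
  (* The upper bound tends to one minus the probability of blue consensus, which is that of red
     consensus because the two sum to 1. *)
  rewrite (_ : P (reaches_consensus sel S0 Red) =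
    1 - P (reaches_consensus sel S0 Blue)); last first.
    rewrite -(reaches_consensus_total gnostic) addeK// fin_num_measure//.
    exact: measurable_reaches_consensus.
  apply: cvgeB; [|exact: cvg_cst|exact: consensus_at_cvg].
  by rewrite fin_num_adde_defr.
(* From an entirely agnostic start no node is ever red: the weights and the limit are 0. *)
have S0N v : S0 v = None by apply: contrapT; exact: agnostic.
have [v] := stationary_inhabited.
rewrite (_ : reaches_consensus _ _ _ = set0); last first.
  by apply/seteqP; split => // w [t /(_ v)]; rewrite agnostic_state// S0N.
rewrite measure0 (_ : (fun t => _) = (fun=> 0)); first exact: cvg_cst.
apply/funext => t; congr (_%:E); apply: big1 => u _.
rewrite /red_prob (_ : mkset _ = set0) ?measure0 ?mulr0//.
by apply/seteqP; split => // w /=; rewrite agnostic_state// S0N.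
Qed.

End Limit.

(** * Summing the drifts to infinity *)

Theorem theorem2 (R : realType) (V : finType) (E : rel V) (H : V -> V -> R)
  (mu : V -> R) (m : update_mode)
  (d : measure_display) (Omega : measurableType d) (P : probability Omega R)
  (sel : nat -> Omega -> selection V) (S0 : config V)
  (hE : strongly_connected E)
  (hH : transition_matrix E H)
  (hmu : stationary_distribution H mu)
  (hsel : random_selections P m H sel)
  (hconv : always_converges P sel) :
  P (reaches_consensus sel S0 Red) =
  \sum_v (mu v * red_indicator R S0 v)%:E +
  \sum_v (mu v)%:E * \sum_(0 <= t <oo) P (red_selects_agnostic sel S0 t v).
Proof.
have mu0 v : (0 <= (mu v)%:E) by case: hmu => mu0 _ _; rewrite lee_fin.
have W0 : red_weight P sel S0 mu 0 = (\sum_v mu v * red_indicator R S0 v)%R.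
  apply: eq_bigr => v _; congr (_ * _)%R; rewrite /red_prob /red_indicator /=.
  case: eqP => Sv.
    by rewrite (_ : mkset _ = setT) ?probability_setT//; apply/seteqP; split.
  by rewrite (_ : mkset _ = set0) ?measure0//; apply/seteqP; split.
(* The partial sums telescope by [red_weightS]. *)
have partial_sum n :
    \sum_(0 <= t < n) \sum_v (mu v)%:E * P (red_selects_agnostic sel S0 t v)
    = (red_weight P sel S0 mu n)%:E - (red_weight P sel S0 mu 0)%:E.
  elim: n => [|n IH]; first by rewrite big_geq// -EFinB subrr.
  rewrite big_nat_recr//= IH (red_weightS S0 hH hsel)// -EFinB.
  under eq_bigr => v _ do
    rewrite -(fineK (fin_num_measure P _ (measurable_red_selects_agnostic S0 hsel n v))) -EFinM.
  by rewrite sumEFin -EFinD; congr (_%:E); rewrite addrAC.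
rewrite sumEFin -W0.
(* All terms are nonnegative, so the weights and the finite sum over nodes move inside the
   series. *)
under [X in _ = _ + X]eq_bigr do rewrite -nneseriesZl//.
rewrite -nneseries_sum; last by move=> v t _; rewrite mule_ge0.
have -> : \sum_(0 <= t <oo) \sum_v (mu v)%:E * P (red_selects_agnostic sel S0 t v)
    = P (reaches_consensus sel S0 Red) - (red_weight P sel S0 mu 0)%:E.
  apply: cvg_lim => //; rewrite (funext partial_sum).
  apply: cvgeB; [by rewrite fin_num_adde_defl| |exact: cvg_cst].
  exact: (red_weight_cvg hmu hsel hconv).
by rewrite addeC subeK.
Qed.
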